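(* For every $s\in[2,n]$ there is a randomized non-adaptive algorithm for $k$-clustering which, for any $\delta>0$, makes \[ O\left(n \log (n/\delta) \log (k/\delta) \cdot \left(\frac{n}{s} + \log s\right)\right) \] subset queries, each on a set of size at most $s$, and for every hidden $k$-clustering of the $n$-point universe outputs the hidden clustering exactly with probability at least $1-\delta$. In particular, taking $\delta=1/\mathrm{poly}(k)$, with unbounded query size the algorithm makes $O(n\log^2 n\log k)$ queries, and when $s=O(n/\log n)$ it makes $O(\frac{n^2}{s}\log n\log k)$ queries.
   Context: Let $U$ be a set of $n$ points with a hidden partition $U=C_1\sqcup\cdots\sqcup C_k$ (a $k$-clustering). A subset query on $S\subseteq U$ returns $\mathsf{count}(S)=|\{i\in[k]: C_i\cap S\neq\emptyset\}|$, the number of clusters intersecting $S$. An algorithm is non-adaptive if its (possibly random) set of queries is fixed before any answer is received; the output is then computed from the answers. *)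

(* Defs.v *)
From HB Require Import structures.
From mathcomp Require Import all_boot all_order all_algebra.
From mathcomp Require Import reals exp.

Set Implicit Arguments.
Unset Strict Implicit.
Unset Printing Implicit Defensive.

Import Order.TTheory GRing.Theory Num.Theory.

Local Open Scope ring_scope.

(* [partition] requires its blocks to be nonempty, so the clustering has exactly
   k nonempty clusters. *)
Definition kclustering (U : finType) (k : nat) (P : {set {set U}}) : Prop :=
  partition P [set: U] /\ #|P| = k.

Definition cluster_count (U : finType) (P : {set {set U}}) (T : {set U}) : nat :=
  #|[set C in P | C :&: T != set0]|.

(* All random bits are gathered in a seed; queries depend on the seed only,
   never on answers. *)
Record nonadaptive_alg (R : realType) (U : finType) := NonadaptiveAlg {
  seed : finType;
  seed_prob : {ffun seed -> R};
  seed_prob_ge0 : forall w, 0 <= seed_prob w;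
  seed_prob_sum1 : \sum_w seed_prob w = 1;
  queries : seed -> seq {set U};
  output : seed -> seq nat -> {set {set U}}
}.

Section Algorithms.
Variables (R : realType) (U : finType) (A : nonadaptive_alg R U).

Definition run (P : {set {set U}}) (w : seed A) : {set {set U}} :=
  output w [seq cluster_count P T | T <- queries w].

Definition success_prob (P : {set {set U}}) : R :=
  \sum_(w | run P w == P) seed_prob A w.

Definition makes_at_most (b : R) : Prop :=
  forall w : seed A, (size (queries w))%:R <= b.

Definition query_size_at_most (s : nat) : Prop :=
  forall (w : seed A) (T : {set U}), T \in queries w -> (#|T| <= s)%N.

End Algorithms.

(* Main.v *)
Require Import Defs.
From HB Require Import structures.
From mathcomp Require Import all_boot all_order all_algebra.
From mathcomp Require Import reals sequences exp.
From mathcomp Require Import zify ring lra.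
Set Implicit Arguments.
Unset Strict Implicit.
Unset Printing Implicit Defensive.
Import Order.TTheory GRing.Theory Num.Theory.

(** For a set [S], the answers on [S] and [x |: S] coincide iff [S] meets the
    cluster of [x]. Querying [S_i] and all the [x |: S_i] for random sets
    [S_1, ..., S_T] thus gives every point a bit vector depending on its cluster
    only, and the clustering is read off as soon as any two clusters [C], [D] are
    separated by some [S_i], i.e. exactly one of them meets [S_i].

    If [S] consists of [m] uniform points, [#|D| <= #|C|] and
    [4 #|C| (m - 1) <= n], then [S] hits [C] once and misses [D] with probability
    at least [m #|C| / (2 n)]. For [m] the largest admissible power of two below
    [s], this is at least [1/16], unless [m] is the top scale, where it is at least
    [s / (4 n)]. Drawing the scale at random with weight about [n / s] on the top
    scale and [1] on each of the others, a random set separates [C] from [D] with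
    probability at least [1 / (16 N)], where [N = O(n / s + ln s)]. A union bound
    over the [k ^ 2] pairs of clusters shows that [T = O(N ln (k / delta))] rounds
    suffice. *)

Local Open Scope nat_scope.

(** * Separation of two clusters at a fixed scale *)

Definition separates (U : finType) (C D S : {set U}) : bool :=
  [disjoint C & S] != [disjoint D & S].

(** All scales [m] read their points off the same [s] draws, so that they share a sample space of
    size [#|U| ^ s] and counts can be added over scales. *)
Definition sample (U : finType) (s m : nat) (f : {ffun 'I_s -> U}) : {set U} :=
  [set f i | i : 'I_s & i < m].

(** Bernoulli's inequality for [(1 - e / n) ^ r], cleared of denominators. *)
Lemma bernoulli_expn n e r : e <= n -> n * n ^ r <= n * (n - e) ^ r + r * e * n ^ r.
Proof.
move=> en; elim: r => [|r IH]; first by rewrite !expn0; lia.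
rewrite !expnS; have : (n - e) ^ r <= n ^ r by case: r {IH} => // r; rewrite leq_exp2r //; lia.
nia.
Qed.

Lemma expn_sub_half n e r : e <= n -> 2 * r * e <= n -> n ^ r <= 2 * (n - e) ^ r.
Proof.
case: n => [|n] en re; first by rewrite sub0n leq_pmull.
by have := bernoulli_expn r en; nia.
Qed.

Lemma card_sample (U : finType) s m (f : {ffun 'I_s -> U}) : #|sample m f| <= m.
Proof.
apply: leq_trans (leq_imset_card _ _) _; rewrite -sum1_card.
case: (leqP m s) => ms.
  rewrite (eq_bigl (fun i : 'I_s => i < m)); last by move=> i; rewrite !inE.
  by rewrite (big_ord_narrow ms) sum1_card card_ord.
by rewrite sum1_card; apply: leq_trans (max_card _) _; rewrite card_ord ltnW.
Qed.

(** The event is a product: the value at [i] lies in [C], those at the [m - 1] other indices below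
    [m] avoid [C :|: D], and the last [s - m] are free. *)
Lemma card_one_hit (U : finType) s m (C D : {set U}) (i : 'I_s) :
  [disjoint C & D] -> i < m -> m <= s ->
  #|[set f : {ffun 'I_s -> U} | (f i \in C) &&
      [forall j : 'I_s, (j != i) && (j < m) ==> (f j \notin C :|: D)]]|
  = #|C| * (#|U| - (#|C| + #|D|)) ^ m.-1 * #|U| ^ (s - m).
Proof.
move=> CD im ms.
pose F (j : 'I_s) : {set U} :=
  if j == i then C else if j < m then ~: (C :|: D) else setT.
rewrite (eq_card (B := family F)); last first.
  move=> f; rewrite !inE; apply/andP/familyP => [[fi /forallP h] j|h].
    rewrite /F; case: eqP => [->//|/eqP ji]; case: ifP => jm; rewrite ?inE //.
    by have := h j; rewrite ji jm /= !inE.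
  split; first by have := h i; rewrite /F eqxx.
  apply/forallP => j; apply/implyP => /andP[ji jm].
  by have := h j; rewrite /F (negbTE ji) jm !inE.
rewrite card_family foldrE big_map big_enum /=.
rewrite (bigD1 i) //= {1}/F eqxx -mulnA; congr (_ * _).
rewrite (bigID (fun j : 'I_s => j < m)) /=; congr (_ * _).
  rewrite (eq_bigr (fun=> #|U| - (#|C| + #|D|))); last first.
    move=> j /andP[ji jm]; rewrite /F (negbTE ji) jm.
    by rewrite cardsCs setCK cardsU (_ : C :&: D = set0) ?cards0 ?subn0 //;
       apply/eqP; rewrite setI_eq0.
  rewrite prod_nat_const; congr (_ ^ _).
  have : \sum_(j < s | j < m) 1 = m by rewrite (big_ord_narrow ms) sum1_card card_ord.
  rewrite (bigD1 i) //= add1n => e; rewrite -sum1_card -[in RHS]e /=.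
  by apply: eq_bigl => j; rewrite andbC.
rewrite (eq_bigr (fun=> #|U|)); last first.
  move=> j /andP[ji jm]; rewrite /F (negbTE ji) (negbTE jm).
  by rewrite cardsT.
rewrite prod_nat_const; congr (_ ^ _).
have := sum1_card 'I_s; rewrite card_ord (bigID (fun j : 'I_s => j < m)) /=.
rewrite (big_ord_narrow ms) sum1_card card_ord => e.
rewrite -sum1_card -[in RHS]e addKn; apply: eq_bigl => j; rewrite unfold_in /=.
by case: (eqVneq j i) => [->|]; rewrite ?im.
Qed.

(** The events that draw [i] hits [C] while the other draws below [m] miss [C :|: D] each imply
    separation and are disjoint for distinct [i]. As [#|C| + #|D| <= 2 * #|C|], the smallness
    hypothesis makes the other draws miss with probability at least one half. *)
Lemma card_separating (U : finType) s m (C D : {set U}) :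
  [disjoint C & D] -> #|D| <= #|C| -> 0 < m <= s -> 4 * #|C| * m.-1 <= #|U| ->
  m * #|C| * #|U| ^ s <=
    2 * #|U| * #|[set f : {ffun 'I_s -> U} | separates C D (sample m f)]|.
Proof.
move=> CD DC /andP[m0 ms] small.
pose E (i : 'I_m) := [set f : {ffun 'I_s -> U} | (f (widen_ord ms i) \in C) &&
  [forall j : 'I_s, (j != widen_ord ms i) && (j < m) ==> (f j \notin C :|: D)]].
have Edis i j : i != j -> [disjoint E i & E j].
  move=> ij; rewrite -setI_eq0; apply/eqP/setP => f; rewrite !inE.
  apply/negP => /andP[/andP[fi _] /andP[_ /forallP /(_ (widen_ord ms i))]].
  have -> : widen_ord ms i != widen_ord ms j.
    by apply: contra ij => /eqP/(congr1 val)/= e; apply/eqP/val_inj.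
  by rewrite /= ltn_ord /= !inE fi.
have sub : \bigcup_i E i \subset [set f | separates C D (sample m f)].
  apply/bigcupsP => i _; apply/subsetP => f; rewrite !inE => /andP[fi /forallP h].
  have inS : f (widen_ord ms i) \in sample m f.
    by apply/imsetP; exists (widen_ord ms i); rewrite ?inE //= ltn_ord.
  have nC : [disjoint C & sample m f] = false.
    by apply/negbTE; rewrite disjoint_sym; apply/pred0Pn; exists (f (widen_ord ms i)); rewrite /= inS.
  rewrite /separates nC eq_sym eqbF_neg negbK disjoint_sym disjoints_subset.
  apply/subsetP => y /imsetP[j]; rewrite inE => jm ->; rewrite inE.
  case: (eqVneq j (widen_ord ms i)) => [->|ji].
    by rewrite (disjointFr CD fi).
  by have := h j; rewrite ji jm /= inE negb_or => /andP[].
have := subset_leq_card sub; rewrite -sum1_card partition_disjoint_bigcup //.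
have cE (i : 'I_m) : \sum_(f in E i) 1 =
    #|C| * (#|U| - (#|C| + #|D|)) ^ m.-1 * #|U| ^ (s - m).
  by rewrite sum1_card; apply: card_one_hit => //=; apply: ltn_ord.
under eq_bigr do rewrite cE.
rewrite sum_nat_const card_ord => le1.
set S := #|[set f | _]| in le1 *.
have cd : #|C| + #|D| <= #|U|.
  by rewrite -cardsUI (_ : C :&: D = set0) ?cards0 ?addn0 ?max_card //;
     apply/eqP; rewrite setI_eq0.
have half := expn_sub_half (r := m.-1) cd _.
have {}half : #|U| ^ m.-1 <= 2 * (#|U| - (#|C| + #|D|)) ^ m.-1 by apply: half; nia.
have -> : #|U| ^ s = #|U| * #|U| ^ m.-1 * #|U| ^ (s - m).
  by rewrite -expnS -expnD prednK // subnKC.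
apply: leq_trans (leq_mul (leqnn (2 * #|U|)) le1).
have := leq_mul (leqnn (m * #|C| * #|U|)) (leq_mul half (leqnn (#|U| ^ (s - m)))).
by rewrite !mulnA => H; apply: leq_trans H _; apply/eq_leq; ring.
Qed.

(** * The random scale *)

Lemma exists_scale n c J : exists2 j, j <= J &
  4 * c * (2 ^ j).-1 <= n /\ (n <= 8 * c * 2 ^ j \/ j = J).
Proof.
elim: J => [|J [j jJ [small [big|e]]]]; first by exists 0 => //=; split; [lia|right].
  by exists j; [lia|split=> //; left].
(* The scale moves up as long as the condition holds; its first failure, at [J.+1], gives
   [n < 8 * c * 2 ^ J] with [j = J]. *)
case: (leqP (4 * c * (2 ^ J.+1).-1) n) => h; first by exists J.+1 => //; split=> //; right.
exists j; first exact: leqW.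
split=> //; left; rewrite e; move: h; rewrite expnS; nia.
Qed.

(** The logarithm of [s.-1] rather than [s] keeps random sets strictly smaller than [s], which
    leaves room for the extra point of [x |: S]. *)
Definition top_scale (s : nat) : nat := trunc_log 2 s.-1.

(* The draws [j >= top_scale s], which number [(n %/ s).+1], all use the top scale. *)
Definition nb_draws (n s : nat) : nat := top_scale s + (n %/ s).+1.

Definition draw (U : finType) (s : nat) : finType :=
  ('I_(nb_draws #|U| s) * {ffun 'I_s -> U})%type.

Definition random_set (U : finType) (s : nat) (x : draw U s) : {set U} :=
  sample (2 ^ minn x.1 (top_scale s)) x.2.

Lemma top_scale_bounds s : 1 < s -> 2 ^ top_scale s < s <= 2 * 2 ^ top_scale s.
Proof.
move=> s1; have /andP[lo hi] := @trunc_log_bounds 2 s.-1 isT ltac:(lia).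
by move: lo hi; rewrite -/(top_scale s) expnS; lia.
Qed.

Lemma card_random_set (U : finType) s (x : draw U s) : 1 < s -> #|random_set x| < s.
Proof.
move=> s1; apply: leq_ltn_trans (card_sample _ _) _.
have /andP[h _] := top_scale_bounds s1.
by apply: leq_ltn_trans h; rewrite leq_exp2l // geq_minr.
Qed.

Lemma separatesC (U : finType) (C D S : {set U}) : separates C D S = separates D C S.
Proof. by rewrite /separates eq_sym. Qed.

Lemma card_random_separating (U : finType) s (C D : {set U}) :
  1 < s -> C != set0 -> D != set0 -> [disjoint C & D] ->
  #|draw U s| <=
    16 * nb_draws #|U| s * #|[set x : draw U s | separates C D (random_set x)]|.
Proof.
move=> s1; wlog DC : C D / #|D| <= #|C|.
  move=> W C0 D0 CD; case: (leqP #|D| #|C|) => [|/ltnW] h; first exact: W.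
  have := W D C h D0 C0; rewrite disjoint_sym => /(_ CD).
  by under eq_finset do rewrite separatesC.
move=> C0 _ CD.
rewrite card_prod card_ffun !card_ord [16 * _]mulnC -mulnA leq_mul2l; apply/orP; right.
set J := top_scale s; pose N := nb_draws #|U| s; set n := #|U|.
pose sep j := #|[set f : {ffun 'I_s -> U} | separates C D (sample (2 ^ j) f)]|.
have -> : #|[set x : draw U s | separates C D (random_set x)]| =
          \sum_(j < N) sep (minn j J).
  rewrite /sep -sum1dep_card; under [RHS]eq_bigr do rewrite -sum1dep_card.
  by rewrite pair_big_dep /=.
have c0 : 0 < #|C| by rewrite card_gt0.
have n0 : 0 < n by apply: leq_trans c0 (max_card _).
have /andP[Jlo Jhi] := top_scale_bounds s1; rewrite -/J in Jlo Jhi.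
have [j jJ [small H]] := exists_scale n #|C| J.
have jbnd : 0 < 2 ^ j <= s.
  by rewrite expn_gt0 /=; apply: leq_trans (ltnW Jlo); rewrite leq_exp2l.
have := card_separating CD DC jbnd small; rewrite -/(sep j) -/n => sepj.
have jN : j < N by rewrite /N /nb_draws addnS ltnS (leq_trans jJ) ?leq_addr.
rewrite -(leq_pmul2l n0); case: H => [big|e].
  (* The single draw at scale [j] is enough here: [n <= 8 * #|C| * 2 ^ j] turns the success rate
     [2 ^ j * #|C| / (2 * n)] into at least [1/16]. *)
  have -> : \sum_(i < N) sep (minn i J) = sep j + \sum_(i < N | i != Ordinal jN) sep (minn i J).
    by rewrite (bigD1 (Ordinal jN)) //= (minn_idPl jJ).
  nia.
have : (n %/ s).+1 * sep J <= \sum_(i < N) sep (minn i J).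
  rewrite -(big_mkord xpredT (fun i => sep (minn i J))) (big_cat_nat (n := J)) //=; last first.
    by rewrite /N /nb_draws -/J leq_addr.
  apply: leq_trans (leq_addl _ _).
  rewrite big_nat (eq_bigr (fun=> sep J)); last by move=> i /andP[/minn_idPr->].
  by rewrite -big_nat sum_nat_const_nat /N /nb_draws -/J addKn.
rewrite e in sepj.
(* The number of top-scale draws makes up for their low success rate:
   [n <= q * s <= q * (2 * 2 ^ J)], so their rates add up to at least a constant. *)
have nds : n <= (n %/ s).+1 * s by rewrite ltnW // ltn_ceil //; lia.
set q := (n %/ s).+1 in nds *; set a := \sum_(i < N) _; set b := n ^ s in sepj *.
move=> qa.
have h1 : n <= q * (2 * 2 ^ J) by apply: leq_trans nds _; rewrite leq_mul2l Jhi orbT.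
have h2 : n * b <= q * (2 * 2 ^ J) * b by rewrite leq_mul2r h1 orbT.
have h3 : q * (2 ^ J * #|C| * b) <= q * (2 * n * sep J) by rewrite leq_mul2l sepj orbT.
have h4 : n * (q * sep J) <= n * a by rewrite leq_mul2l qa orbT.
nia.
Qed.

(** * What the answers reveal about a point *)

Lemma cluster_countU1 (U : finType) (P : {set {set U}}) (x : U) (S : {set U}) :
  partition P setT ->
  (cluster_count P (x |: S) == cluster_count P S) = ~~ [disjoint pblock P x & S].
Proof.
move=> /and3P[/eqP covP tiP n0].
have xc : x \in cover P by rewrite covP inE.
(* Adding [x] to [S] can only add the cluster of [x] to those that are met, so the count grows
   exactly when [S] misses that cluster. *)
have -> : cluster_count P (x |: S) =
    #|pblock P x |: [set C in P | C :&: S != set0]|.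
  apply: eq_card => C; rewrite !inE; case: (boolP (C \in P)) => CP /=; last first.
    by rewrite orbF; apply/esym/negbTE; apply: contra CP => /eqP->; apply: pblock_mem.
  rewrite setIUr; case: (boolP (x \in C)) => xC.
    rewrite (def_pblock tiP CP xC) eqxx /=; apply/set0Pn; exists x.
    by rewrite !inE xC eqxx.
  have -> : C :&: [set x] = set0.
    by apply/eqP; rewrite setI_eq0 disjoint_sym disjoints1.
  rewrite set0U; case: (eqVneq C (pblock P x)) => // e.
  by case/negP: xC; rewrite e mem_pblock.
rewrite cardsU1 inE pblock_mem //= setI_eq0 /cluster_count.
by rewrite -[X in _ == X]add0n eqn_add2r; case: [disjoint _ & _].
Qed.

Local Open Scope ring_scope.

(** * The algorithm and its success probability *)

Section UniformSamplingAlgorithm.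
Variables (R : realType) (U : finType) (s T : nat).
Hypothesis U_gt0 : (0 < #|U|)%N.

Let W : finType := {ffun 'I_T -> draw U s}.

Lemma draws_gt0 : (0 < #|W|)%N.
Proof.
rewrite card_ffun expn_gt0 card_prod card_ffun !card_ord muln_gt0 expn_gt0 U_gt0.
by rewrite /nb_draws addnS.
Qed.

Definition uniform_prob : {ffun W -> R} := [ffun=> #|W|%:R^-1].

Lemma uniform_prob_ge0 w : 0 <= uniform_prob w.
Proof. by rewrite ffunE invr_ge0. Qed.

Lemma uniform_prob_sum1 : \sum_w uniform_prob w = 1.
Proof.
under eq_bigr do rewrite ffunE.
by rewrite sumr_const -[LHS]mulr_natl mulfV // pnatr_eq0 -lt0n draws_gt0.
Qed.

Definition sampled_queries (w : W) : seq {set U} :=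
  flatten [seq random_set (w i) :: [seq x |: random_set (w i) | x <- enum U]
             | i <- enum 'I_T].

(** Looking up the first occurrence is harmless when a set is queried twice, since equal queries
    have equal answers. *)
Definition answer_to (w : W) (a : seq nat) (S : {set U}) : nat :=
  nth 0%N a (index S (sampled_queries w)).

Definition signature (w : W) (a : seq nat) (x : U) : {ffun 'I_T -> bool} :=
  [ffun i => answer_to w a (x |: random_set (w i)) == answer_to w a (random_set (w i))].

Definition sampling_alg : nonadaptive_alg R U :=
  NonadaptiveAlg uniform_prob_ge0 uniform_prob_sum1 sampled_queries
    (fun w a => preim_partition (signature w a) [set: U]).

Lemma size_sampled_queries w : size (sampled_queries w) = (T * #|U|.+1)%N.
Proof.
rewrite size_flatten /shape -map_comp (eq_map (g := fun=> #|U|.+1)); last first.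
  by move=> i /=; rewrite size_map -cardE.
by rewrite sumnE big_map big_const_seq count_predT -cardT card_ord iter_addn_0 mulnC.
Qed.

Lemma card_sampled_queries w S :
  (1 < s)%N -> S \in sampled_queries w -> (#|S| <= s)%N.
Proof.
move=> s1 /flattenP[qs /mapP[i _ ->]]; have h := card_random_set (w i) s1.
rewrite inE => /orP[/eqP->|/mapP[x _ ->]]; first exact: ltnW.
by rewrite cardsU1; case: (_ \notin _) => //; rewrite add0n ltnW.
Qed.

Lemma signatureE (P : {set {set U}}) w x i : partition P setT ->
  signature w [seq cluster_count P Q | Q <- sampled_queries w] x i =
  ~~ [disjoint pblock P x & random_set (w i)].
Proof.
move=> partP; rewrite ffunE -cluster_countU1 //.
have ansE S : S \in sampled_queries w ->
    answer_to w [seq cluster_count P Q | Q <- sampled_queries w] S = cluster_count P S.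
  by move=> h; rewrite /answer_to (nth_map set0) ?index_mem // nth_index.
have mem S : S \in random_set (w i) :: [seq y |: random_set (w i) | y <- enum U] ->
    S \in sampled_queries w.
  by move=> h; apply/flatten_mapP; exists i; rewrite ?mem_enum.
rewrite !ansE //; apply: mem; rewrite inE ?eqxx //.
by apply/orP; right; apply: map_f; rewrite mem_enum.
Qed.

Definition undistinguished (C D : {set U}) : {set W} :=
  [set w : W | [forall i : 'I_T, ~~ separates C D (random_set (w i))]].

(** [P] is the kernel partition of [pblock P], and the output that of the signature. The signature
    depends on the cluster only, and separation makes it injective on clusters, so the two kernels
    agree. *)
Lemma run_sampling (P : {set {set U}}) (w : W) : partition P setT ->
  (forall C D, C \in P -> D \in P -> C != D -> w \notin undistinguished C D) ->
  run (A := sampling_alg) P w = P.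
Proof.
move=> partP sepP; have [/eqP covP tiP _] := and3P partP.
have blockP x : pblock P x \in P by apply: pblock_mem; rewrite covP inE.
rewrite -[RHS](preim_partition_pblock partP) /run /= /preim_partition.
rewrite /equivalence_partition; apply: eq_imset => x; apply/setP => y.
rewrite !inE; apply/eqP/eqP => [e|e]; last first.
  by apply/ffunP => i; rewrite !signatureE // e.
apply/eqP; apply/negPn/negP => /(sepP _ _ (blockP x) (blockP y)).
rewrite inE negb_forall => /existsP[i]; rewrite negbK /separates.
by have := congr1 (fun g : {ffun _} => g i) e; rewrite !signatureE // => /negb_inj->; rewrite eqxx.
Qed.

Lemma card_undistinguished C D :
  #|undistinguished C D| =
  ((#|draw U s| - #|[set x : draw U s | separates C D (random_set x)]|) ^ T)%N.
Proof.
rewrite -[in RHS](card_ord T).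
rewrite -(_ : #|~: [set x : draw U s | separates C D (random_set x)]| = (#|draw U s| - _)%N);
  last by rewrite cardsCs setCK.
rewrite -card_ffun_on; apply: eq_card => w; rewrite !inE.
by apply: eq_forallb => i; rewrite !inE.
Qed.

(** The [T] draws are independent and each fails with probability at most [1 - 1 / (16 * N)], where
    [N] is the number of scale draws; then [1 + x <= expR x]. *)
Lemma prob_undistinguished C D :
  (1 < s)%N -> C != set0 -> D != set0 -> [disjoint C & D] ->
  #|undistinguished C D|%:R / #|W|%:R <=
    expR (- (T%:R / (16 * (nb_draws #|U| s)%:R))) :> R.
Proof.
move=> s1 C0 D0 CD; rewrite card_undistinguished card_ffun card_ord.
set X := #|draw U s|; set N := nb_draws _ _.
set G := #|_|.
have le : (X <= 16 * N * G)%N by apply: card_random_separating.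
have GX : (G <= X)%N by apply: max_card.
have X0 : 0 < X%:R :> R.
  rewrite ltr0n /X card_prod card_ffun !card_ord muln_gt0 expn_gt0 U_gt0 andbT.
  by rewrite /nb_draws addnS.
have N0 : 0 < N%:R :> R by rewrite ltr0n /N /nb_draws addnS.
rewrite !natrX -exprVn -exprMn mulrC -mulrN expRM_natl lerXn2r ?nnegrE ?expR_ge0 //.
  by rewrite mulr_ge0 // invr_ge0.
apply: le_trans (expR_ge1Dx _).
rewrite natrB // mulrC mulrBl divff ?gt_eqF // lerD2l lerN2.
rewrite ler_pdivlMr // mulrC ler_pdivrMr ?mulr_gt0 //.
by rewrite -!natrM mulnC ler_nat.
Qed.

Lemma success_sampling (P : {set {set U}}) k (delta : R) :
  (1 < s)%N -> kclustering k P -> (1 < k)%N -> 0 < delta ->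
  16 * (nb_draws #|U| s)%:R * ln (k%:R ^+ 2 / delta) <= T%:R ->
  1 - delta <= success_prob sampling_alg P.
Proof.
move=> s1 [partP cardP] k1 d0 Tbig; have [_ tiP P0] := and3P partP.
have N0 : 0 < (nb_draws #|U| s)%:R :> R by rewrite ltr0n /nb_draws addnS.
have k0 : 0 < k%:R :> R by rewrite ltr0n ltnW.
have q0 : 0 < delta / k%:R ^+ 2 by rewrite divr_gt0 ?exprn_gt0.
pose pairs := [set CD : {set U} * {set U} |
  [&& CD.1 \in P, CD.2 \in P & CD.1 != CD.2]].
pose bad : {set W} := \bigcup_(CD in pairs) undistinguished CD.1 CD.2.
have badP : (#|bad|%:R / #|W|%:R : R) <= delta.
  (* Union bound: each of the at most [k * k] pairs gets the share [delta / k ^ 2]. *)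
  have -> : delta = (k * k)%:R * (delta / k%:R ^+ 2).
    by rewrite natrM expr2; field; rewrite gt_eqF.
  apply: (@le_trans _ _ (\sum_(CD in pairs) (#|undistinguished CD.1 CD.2|%:R / #|W|%:R : R))).
    rewrite -mulr_suml ler_wpM2r ?invr_ge0 // -natr_sum ler_nat.
    rewrite /bad; elim/big_rec2: _ => [|CD m B _ h]; first by rewrite cards0.
    by rewrite cardsU; apply: leq_trans (leq_subr _ _) _; rewrite leq_add2l.
  apply: (@le_trans _ _ (\sum_(CD in pairs) (delta / k%:R ^+ 2))).
    apply: ler_sum => -[C D]; rewrite inE /= => /and3P[CP DP CD].
    have C0 : C != set0 by apply: contraNneq P0 => <-.
    have D0 : D != set0 by apply: contraNneq P0 => <-.
    have dis : [disjoint C & D] by apply: (trivIsetP tiP).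
    apply: le_trans (prob_undistinguished s1 C0 D0 dis) _.
    (* After taking logarithms this is the hypothesis on [T]. *)
    rewrite -[leRHS]lnK ?posrE // ler_expR lerNl -lnV ?posrE // invf_div.
    by rewrite ler_pdivlMr ?mulr_gt0 // mulrC.
  rewrite sumr_const -[leLHS]mulr_natl ler_wpM2r ?(ltW q0) //.
  rewrite ler_nat -cardP -cardsX; apply: subset_leq_card.
  by apply/subsetP => -[C D]; rewrite !inE /= => /and3P[-> ->].
rewrite /success_prob /=.
rewrite (eq_bigr (fun=> #|W|%:R^-1)); last by move=> w _; rewrite ffunE.
apply: (@le_trans _ _ (\sum_(w in ~: bad) #|W|%:R^-1)); last first.
  rewrite big_mkcond [leRHS]big_mkcond; apply: ler_sum => w _.
  case: ifP => [wb|_]; last by case: ifP => // _; rewrite invr_ge0.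
  rewrite (_ : run (A := sampling_alg) P w == P) //.
  apply/eqP; apply: run_sampling => // C D CP DP CD.
  move: wb; rewrite inE; apply: contra => wu; apply/bigcupP; exists (C, D) => //.
  by rewrite inE /= CP DP.
have W0 : 0 < #|W|%:R :> R by rewrite ltr0n draws_gt0.
rewrite sumr_const -[leRHS]mulr_natl cardsCs setCK natrB ?max_card // mulrBl divff ?gt_eqF //.
by rewrite lerD2l lerN2.
Qed.

End UniformSamplingAlgorithm.

(** * Bounds on the number of queries *)

Lemma ln_ge_half (R : realType) (x : R) : 2 <= x -> 2^-1 <= ln x.
Proof.
move=> x2; have x0 : 0 < x by lra.
rewrite -[leLHS]expRK ler_ln ?posrE ?expR_gt0 // (le_trans _ x2) //.
(* [expR (- 1/2) >= 1 - 1/2] gives [expR (1/2) <= 2]. *)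
have := @expR_ge1Dx R (- 2^-1); rewrite expRN => h.
have e0 := @expR_gt0 R 2^-1.
have : expR 2^-1 * (1 + - 2^-1) <= expR (2^-1 : R) * (expR 2^-1)^-1 by rewrite ler_pM2l.
by rewrite divff ?gt_eqF //; lra.
Qed.

(** [2 ^ top_scale s <= s] and [ln 2 >= 1/2] bound the top scale by [2 * ln s]; the extra draw is
    absorbed by [1 <= n / s]. *)
Lemma nb_draws_le (R : realType) (n s : nat) : (1 < s <= n)%N ->
  (nb_draws n s)%:R <= 2 * (n%:R / s%:R + ln s%:R) :> R.
Proof.
move=> /andP[s1 sn]; have s0 : 0 < s%:R :> R by rewrite ltr0n; lia.
have le1 : (n %/ s)%:R <= n%:R / s%:R :> R.
  by rewrite ler_pdivlMr // -natrM ler_nat leq_trunc_div.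
have le2 : 1 <= n%:R / s%:R :> R by rewrite ler_pdivlMr // mul1r ler_nat.
have le3 : (top_scale s)%:R / 2 <= ln s%:R :> R.
  have /andP[/ltnW lo _] := top_scale_bounds s1.
  apply: (@le_trans _ _ (ln ((2 ^ top_scale s)%N%:R))); last first.
    by rewrite ler_ln ?posrE ?ltr0n ?expn_gt0 // ?ler_nat //; lia.
  rewrite natrX lnXn ?ltr0n // -[leRHS]mulr_natl ler_wpM2l //.
  exact: ln_ge_half.
rewrite /nb_draws natrD -natr1; lra.
Qed.

(** No query is made when the clustering is known in advance or the guarantee is void, because the
    claimed bound can vanish in these cases. *)
Definition nb_rounds (R : realType) (n k s : nat) (delta : R) : nat :=
  if (k <= 1)%N || (1 <= delta) then 0%N
  else (Num.truncn (16 * (nb_draws n s)%:R * ln (k%:R ^+ 2 / delta))).+1.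

Lemma nb_rounds_le (R : realType) (n k s : nat) (delta : R) :
  (1 <= k <= n)%N -> (1 < s <= n)%N -> 0 < delta ->
  (nb_rounds n k s delta * n.+1)%:R <=
    272 * `| n%:R * ln (n%:R / delta) * ln (k%:R / delta) * (n%:R / s%:R + ln s%:R) |.
Proof.
move=> /andP[k0 kn] sn d0; rewrite /nb_rounds.
case: ifPn => [_|]; first by rewrite mul0n mulr_ge0.
rewrite negb_or -ltnNge -ltNge => /andP[k1 d1].
have N1 : 1 <= (nb_draws n s)%:R :> R by rewrite ler1n /nb_draws addnS.
have Nle := nb_draws_le R sn.
set N := (nb_draws n s)%:R in N1 Nle *; set r := _ + ln _ in Nle *.
have n2 : 2 <= n%:R :> R by rewrite ler_nat (leq_trans k1).
have k2 : 2 <= k%:R :> R by rewrite ler_nat.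
have divd (x : R) : 2 <= x -> 2 <= x / delta.
  by move=> x2; rewrite ler_pdivlMr //; nra.
have L1 := ln_ge_half (divd _ n2); have L2 := ln_ge_half (divd _ k2).
have L3 : ln (k%:R ^+ 2 / delta) <= 2 * ln (k%:R / delta).
  have kd0 : 0 < k%:R / delta by rewrite divr_gt0 //; lra.
  rewrite mulr_natl -lnXn // ler_ln ?posrE ?divr_gt0 ?exprn_gt0 //; try lra.
  rewrite expr_div_n ler_wpM2l ?exprn_ge0 // lef_pV2 ?posrE ?exprn_gt0 //.
  by rewrite expr2; nra.
have L4 : 0 <= ln (k%:R ^+ 2 / delta).
  apply: ln_ge0; rewrite ler_pdivlMr // expr2; nra.
set a := ln (n%:R / delta) in L1 *; set b := ln (k%:R / delta) in L2 L3 *.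
(* [34 = 16 * 2 + 2]: the logarithm is at most [2 * b], and the successor costs
   [1 <= 2 * (N * b)]. *)
have Tle : (Num.truncn (16 * N * ln (k%:R ^+ 2 / delta))).+1%:R <= 34 * (N * b).
  have := truncn_le (16 * N * ln (k%:R ^+ 2 / delta)).
  rewrite (_ : 0 <= _ = true); last by rewrite !mulr_ge0 //; lra.
  move: (Num.truncn _) => t /idP; rewrite -natr1 => le.
  have : N * ln (k%:R ^+ 2 / delta) <= N * (2 * b) by rewrite ler_pM2l //; lra.
  have : 1 * 2^-1 <= N * b by apply: ler_pM => //; lra.
  lra.
have r0 : 0 <= r by lra.
have b0 : 0 <= b by lra.
have a0 : 0 <= a by lra.
rewrite ger0_norm ?mulr_ge0 // natrM.
(* [272 = 34 * 2 * 2 * 2], from [N <= 2 * r], [n + 1 <= 2 * n] and [1 <= 2 * a]. *)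
apply: (@le_trans _ _ (34 * (2 * r * b) * (2 * n%:R))).
  apply: ler_pM => //; last by rewrite -natr1; lra.
  by apply: le_trans Tle _; rewrite ler_pM2l // ler_wpM2r.
have nrb0 : 0 <= n%:R * (r * b) by rewrite !mulr_ge0.
have := ler_wpM2l nrb0 L1.
lra.
Qed.

(* The absolute value is that of the definition of big-O; it only matters for
   delta > 1, where the logarithms may be negative. "delta = 1/poly(k)" is read
   as k^-c <= delta <= 1 for a constant exponent c; "unbounded query size" as
   s = n; "s = O(n / log n)" as s <= B * n / ln n for a constant B. *)
Theorem theorem3p1 (R : realType) :
  exists (K : R) (K1 : nat -> R) (K2 : nat -> R -> R),
  forall (U : finType) (n k s : nat),
    #|U| = n -> (1 <= k <= n)%N -> (2 <= s <= n)%N ->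
  exists A : R -> nonadaptive_alg R U,
  [/\ forall delta : R, 0 < delta ->
        [/\ makes_at_most (A delta)
              (K * `| n%:R * ln (n%:R / delta) * ln (k%:R / delta)
                      * (n%:R / s%:R + ln s%:R) |),
            query_size_at_most (A delta) s
          & forall P : {set {set U}}, kclustering k P ->
              1 - delta <= success_prob (A delta) P],
      forall (c : nat) (delta : R), (k%:R ^+ c)^-1 <= delta <= 1 -> s = n ->
        makes_at_most (A delta) (K1 c * (n%:R * ln n%:R ^+ 2 * ln k%:R))
    & forall (c : nat) (B delta : R), (k%:R ^+ c)^-1 <= delta <= 1 ->
        s%:R <= B * (n%:R / ln n%:R) ->
        makes_at_most (A delta) (K2 c B * (n%:R ^+ 2 / s%:R * ln n%:R * ln k%:R))].
Proof.
(* The factors [3] and [1 + B] bound [n / s + ln s] against [ln n] when [s = n], and against [n / s]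
   when [ln n <= B * n / s]. *)
exists 272, (fun c => 272 * (3 * c.+1%:R ^+ 2)),
  (fun c B => 272 * ((1 + B) * c.+1%:R ^+ 2)).
move=> U n k s cU kn sn; have [s1 sn'] := andP sn; have [k0 kn'] := andP kn.
have U0 : (0 < #|U|)%N by rewrite cU; lia.
exists (fun delta => sampling_alg R s (nb_rounds n k s delta) U0).
have main delta : 0 < delta -> makes_at_most (sampling_alg R s (nb_rounds n k s delta) U0)
    (272 * `| n%:R * ln (n%:R / delta) * ln (k%:R / delta) * (n%:R / s%:R + ln s%:R) |).
  by move=> d0 w; rewrite size_sampled_queries cU; apply: nb_rounds_le.
have n2 : 2 <= n%:R :> R by rewrite ler_nat; lia.
have s2 : 2 <= s%:R :> R by rewrite ler_nat.
have k1 : 1 <= k%:R :> R by rewrite ler1n.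
have knR : k%:R <= n%:R :> R by rewrite ler_nat.
have snR : s%:R <= n%:R :> R by rewrite ler_nat.
have lnk0 : 0 <= ln k%:R :> R by apply: ln_ge0.
have lnkn : ln k%:R <= ln n%:R :> R by rewrite ler_ln ?posrE //; lra.
have lnsn : ln s%:R <= ln n%:R :> R by rewrite ler_ln ?posrE //; lra.
have lnn : 2^-1 <= ln n%:R :> R by apply: ln_ge_half.
have lns : 2^-1 <= ln s%:R :> R by apply: ln_ge_half.
have ns0 : 0 <= n%:R / s%:R :> R by rewrite divr_ge0.
(* Since [- ln delta <= c * ln k <= c * ln n], each of the two logarithms containing [delta] grows
   by a factor of at most [c + 1]. *)
have poly c (delta r : R) : (k%:R ^+ c)^-1 <= delta <= 1 -> n%:R / s%:R + ln s%:R <= r ->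
    makes_at_most (sampling_alg R s (nb_rounds n k s delta) U0)
      (272 * (c.+1%:R ^+ 2 * (n%:R * ln n%:R * ln k%:R * r))).
  move=> /andP[dlo dhi] hr w.
  have kc0 : 0 < k%:R ^+ c :> R by rewrite exprn_gt0 //; lra.
  have d0 : 0 < delta by apply: lt_le_trans dlo; rewrite invr_gt0.
  apply: le_trans (main _ d0 w) _; rewrite ler_pM2l //.
  have lnd : 0 <= - ln delta <= c%:R * ln k%:R.
    rewrite oppr_ge0 ln_le0 //= -lnV ?posrE // mulr_natl -lnXn; last lra.
    by rewrite ler_ln ?posrE ?invr_gt0 // -[leRHS]invrK lef_pV2 ?posrE ?invr_gt0.
  have lnE (x : R) : 0 < x -> ln (x / delta) = ln x + - ln delta.
    by move=> x0; rewrite lnM ?posrE ?invr_gt0 // lnV.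
  rewrite !lnE; try lra.
  have /andP[l0 lc] := lnd.
  have lcn : c%:R * ln k%:R <= c%:R * ln n%:R :> R by rewrite ler_wpM2l.
  have E1 : 0 <= ln n%:R + - ln delta <= c.+1%:R * ln n%:R by rewrite -natr1; lra.
  have E2 : 0 <= ln k%:R + - ln delta <= c.+1%:R * ln k%:R by rewrite -natr1; lra.
  have [E1a E1b] := andP E1; have [E2a E2b] := andP E2.
  rewrite ger0_norm ?mulr_ge0 //; last by lra.
  have -> : c.+1%:R ^+ 2 * (n%:R * ln n%:R * ln k%:R * r) =
    n%:R * (c.+1%:R * ln n%:R) * (c.+1%:R * ln k%:R) * r :> R by ring.
  apply: ler_pM => //; rewrite ?mulr_ge0 //; first lra.
  by apply: ler_pM => //; rewrite ?mulr_ge0 // ler_wpM2l.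
split.
- move=> delta d0; split; first exact: main.
    by move=> w S; apply: card_sampled_queries.
  move=> P kP; case: (leP 1 delta) => d1.
    by apply: (@le_trans _ _ 0); [lra|apply: sumr_ge0 => w _; apply: seed_prob_ge0].
  case: (leqP k 1) => k_1; last first.
    apply: (success_sampling _ s1 kP k_1 d0); rewrite cU /nb_rounds (leqNgt k) k_1 (lt_geF d1) /=.
    by rewrite ltW // truncnS_gt.
  (* With a single cluster there is no pair to separate, so every seed recovers [P], even without
     any round. *)
  case: kP => partP cardP.
  rewrite /success_prob (eq_bigl xpredT) ?seed_prob_sum1; first lra.
  move=> w; apply/eqP; apply: run_sampling => // C D CP DP CD.
  have : (#|P| <= 1)%N by rewrite cardP.
  by move/card_le1_eqP => /(_ C D CP DP) e; rewrite e eqxx in CD.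
- move=> c delta dk sE w.
  have hr : n%:R / s%:R + ln s%:R <= 3 * ln n%:R :> R.
    by rewrite sE divff ?gt_eqF //; lra.
  by apply: le_trans (poly c delta _ dk hr w) _; rewrite le_eqVlt; apply/orP; left;
     apply/eqP; ring.
- move=> c B delta dk sB w.
  have hr : n%:R / s%:R + ln s%:R <= (1 + B) * (n%:R / s%:R) :> R.
    rewrite mulrDl mul1r lerD2l (le_trans lnsn) // mulrA ler_pdivlMr; last lra.
    by move: sB; rewrite mulrA ler_pdivlMr 1?mulrC //; lra.
  by apply: le_trans (poly c delta _ dk hr w) _; rewrite le_eqVlt; apply/orP; left;
     apply/eqP; field; rewrite gt_eqF //; lra.
Qed.
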